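(* For every order frame $\langle W,<\rangle$: the schema Flattening, $(p>((p\wedge q)>r))\leftrightarrow((p\wedge q)>r)$, is valid on $\langle W,<\rangle$ if and only if $\langle W,<\rangle$ is flat.
   Context: Language. Let $At=\{p_0,p_1,\ldots\}$ be a countably infinite set of atoms. $\mathcal{L}_>$ is generated by $p ::= p_k\in At\mid \neg p\mid (p\wedge p)\mid (p>p)$; $\vee,\to,\leftrightarrow$ are defined as usual. Order frames and models. An order frame is a pair $\langle W,<\rangle$ where $W\neq\varnothing$ and $<$ is a function taking each $w\in W$ to a strict well-order $<_w$ on some subset of $W$ such that whenever $x<_w y$, either $w=x$ or $w<_w x$. Its accessibility relation is $R(w)=\{w\}\cup\{v: w<_w v\}$ (write $wRv$ for $v\in R(w)$). An order model $\langle W,<,V\rangle$ adds a valuation $V:At\times W\to\{0,1\}$; put $V(p_k)=\{w:V(p_k,w)=1\}$. Denotations: $[\![p_k]\!]=V(p_k)$, $[\![\neg p]\!]=W\setminus[\![p]\!]$, $[\![p\wedge q]\!]=[\![p]\!]\cap[\![q]\!]$, and $w\in[\![p>q]\!]$ iff either $R(w)\cap[\![p]\!]=\varnothing$, or there is $y\in R(w)\cap[\![p]\!]\cap[\![q]\!]$ such that $x\notin[\![p]\!]$ whenever $x<_w y$. A sentence $p$ is true at $w$ iff $w\in[\![p]\!]$. A schema is valid on an order frame iff each of its instances in $\mathcal{L}_>$ is true at every $w\in W$ in every order model based on that frame. An order frame is semi-flat iff whenever $x<_w y$, we have $y\in R(x)$ and, for all $z$ such that $y<_w z$ or $z\in R(x)\setminus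 R(w)$, $y<_x z$. It is flat iff it is semi-flat and its accessibility relation $R$ is transitive. *)

(* Defs.v *)
From Stdlib Require Import RelationClasses.

Set Implicit Arguments.

Inductive formula : Type :=
| Atom (k : nat)
| Neg (p : formula)
| And (p q : formula)
| Cond (p q : formula).

Definition Imp (p q : formula) : formula := Neg (And p (Neg q)).
Definition Iff (p q : formula) : formula := And (Imp p q) (Imp q p).

(* By [swo_field], elements outside [S] are isolated, so requiring
   irreflexivity, transitivity and well-foundedness on all of [W] amounts to
   requiring them on [S]. *)
Record strict_well_order_on (W : Type) (S : W -> Prop) (r : W -> W -> Prop)
  : Prop := {
  swo_field : forall x y, r x y -> S x /\ S y;
  swo_strict : StrictOrder r;
  swo_connected : forall x y, S x -> S y -> r x y \/ x = y \/ r y x;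
  swo_wf : well_founded r
}.

(* [lt w x y] is x <_w y. *)
Record order_frame : Type := {
  world :> Type;
  world_inhabited : inhabited world;
  lt : world -> world -> world -> Prop;
  lt_well_order : forall w, exists S, strict_well_order_on S (lt w);
  lt_center : forall w x y, lt w x y -> w = x \/ lt w w x
}.

Arguments lt {o} w x y.

Definition acc (F : order_frame) (w v : F) : Prop := v = w \/ lt w w v.

Definition valuation (F : order_frame) : Type := nat -> F -> bool.

(* [denot V p w] is membership of [w] in the denotation of [p] in the order
   model [(F, V)]. *)
Fixpoint denot (F : order_frame) (V : valuation F) (p : formula) (w : F)
  : Prop :=
  match p with
  | Atom k => V k w = true
  | Neg p => ~ denot V p w
  | And p q => denot V p w /\ denot V q w
  | Cond p q =>
      (~ exists v, acc F w v /\ denot V p v) \/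
      (exists y, (acc F w y /\ denot V p y /\ denot V q y) /\
         forall x, lt w x y -> ~ denot V p x)
  end.

(* A schema is represented by the set of its instances. *)
Definition schema : Type := formula -> Prop.

Definition valid (F : order_frame) (A : schema) : Prop :=
  forall p, A p -> forall (V : valuation F) (w : F), denot V p w.

Definition Flattening : schema := fun s =>
  exists p q r : formula,
    s = Iff (Cond p (Cond (And p q) r)) (Cond (And p q) r).

Definition semi_flat (F : order_frame) : Prop :=
  forall w x y : F, lt w x y ->
    acc F x y /\
    forall z : F, lt w y z \/ (acc F x z /\ ~ acc F w z) -> lt x y z.

Definition flat (F : order_frame) : Prop :=
  semi_flat F /\ Transitive (acc F).

(* Main.v *)
Require Import Defs.
From Stdlib Require Import RelationClasses Classical ClassicalEpsilon.

(** On a flat frame, let [y] be the [<_w]-least [p]-world of [R(w)].  Transitivity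
    and semi-flatness make the [p]-worlds of [R(w)] and of [R(y)] coincide, and
    [<_y] extends [<_w] above [y]; hence the least [p /\ q]-world is the same seen
    from [w] and from [y].  Conversely, since atoms may denote arbitrary sets,
    Flattening can be tested on [p = {x, y}], [q = {y}], [r] empty, which gives
    transitivity and the accessibility clause of semi-flatness, and on
    [p = {x, y, z}], [q = {y, z}], [r = {y}], which gives its ordering clause. *)

(** The clause of [denot] for the conditional, with arbitrary sets of worlds in place of
    denotations. *)
Definition cond (F : order_frame) (P Q : F -> Prop) (w : F) : Prop :=
  (~ exists v, acc F w v /\ P v) \/
  (exists y, (acc F w y /\ P y /\ Q y) /\ forall x, lt w x y -> ~ P x).

Definition least (F : order_frame) (P : F -> Prop) (w y : F) : Prop :=
  acc F w y /\ P y /\ forall x, lt w x y -> ~ P x.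

Lemma lt_irrefl (F : order_frame) (w x : F) : ~ lt w x x.
Proof.
  destruct (lt_well_order F w) as [S [_ [Hirr _] _ _]]. exact (Hirr x).
Qed.

Lemma lt_trans (F : order_frame) (w x y z : F) :
  lt w x y -> lt w y z -> lt w x z.
Proof.
  destruct (lt_well_order F w) as [S [_ [_ Htr] _ _]]. apply Htr.
Qed.

Lemma lt_total (F : order_frame) (w x y : F) :
  acc F w x -> acc F w y -> lt w x y \/ x = y \/ lt w y x.
Proof.
  destruct (lt_well_order F w) as [S [Hf _ Hc _]].
  intros [-> | Hx] [-> | Hy]; auto.
  apply Hc; [apply (Hf _ _ Hx) | apply (Hf _ _ Hy)].
Qed.

Lemma lt_acc_l (F : order_frame) (w x y : F) : lt w x y -> acc F w x.
Proof.
  intros H. destruct (lt_center F w x y H) as [-> | H']; [left | right]; auto.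
Qed.

Lemma lt_acc_r (F : order_frame) (w x y : F) : lt w x y -> acc F w y.
Proof.
  intros H. right. destruct (lt_center F w x y H) as [-> | H']; auto.
  eapply lt_trans; eassumption.
Qed.

Lemma least_exists (F : order_frame) (P : F -> Prop) (w : F) :
  (exists v, acc F w v /\ P v) -> exists y, least F P w y.
Proof.
  intros [v [Hv HP]].
  destruct (lt_well_order F w) as [S [_ _ _ Hwf]].
  induction (Hwf v) as [v _ IH].
  destruct (classic (exists x, lt w x v /\ P x)) as [[x [Hx HPx]] | Hno].
  - exact (IH x Hx (lt_acc_l F w x v Hx) HPx).
  - exists v. repeat split; auto. intros x Hx HPx. apply Hno. now exists x.
Qed.

Lemma least_le (F : order_frame) (P : F -> Prop) (w y x : F) :
  least F P w y -> acc F w x -> P x -> y = x \/ lt w y x.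
Proof.
  intros (Hy & _ & Hmin) Hx HPx.
  destruct (lt_total F w y x Hy Hx) as [H | [H | H]]; auto.
  now apply Hmin in H.
Qed.

(** The least [P]-world is unique because [<_w] is total on [R(w)], so a non-vacuous conditional
    reduces to a check at one world. *)
Lemma cond_least (F : order_frame) (P Q : F -> Prop) (w y : F) :
  least F P w y -> (cond F P Q w <-> Q y).
Proof.
  intros Hy. pose proof Hy as (Hacc & HP & Hmin). split.
  - intros [Hno | [x [(Hx & HPx & HQx) Hxmin]]].
    + contradict Hno. now exists y.
    + destruct (least_le F P w y x Hy Hx HPx) as [-> | H]; auto.
      now apply Hxmin in H.
  - intros HQ. right. now exists y.
Qed.

(** Three distinct atoms can denote any three sets, since excluded middle turns predicates into
    Boolean valuations; conversely, denotations are themselves sets. *)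
Lemma valid_Flattening_sets (F : order_frame) :
  valid F Flattening <->
  forall (P Q R : F -> Prop) (w : F),
    cond F P (cond F (fun v => P v /\ Q v) R) w <->
    cond F (fun v => P v /\ Q v) R w.
Proof.
  split.
  - intros Hval P Q R w.
    set (b := fun (X : F -> Prop) v =>
                if excluded_middle_informative (X v) then true else false).
    assert (Hb : forall X v, b X v = true <-> X v).
    { intros X v. unfold b.
      destruct (excluded_middle_informative (X v)); split; easy. }
    set (V := (fun k => match k with 0 => b P | 1 => b Q | _ => b R end)
              : valuation F).
    pose proof (Hval _ (ex_intro _ (Atom 0) (ex_intro _ (Atom 1)
                  (ex_intro _ (Atom 2) eq_refl))) V w) as H.
    change (denot V (Iff (Cond (Atom 0) (Cond (And (Atom 0) (Atom 1)) (Atom 2)))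
                         (Cond (And (Atom 0) (Atom 1)) (Atom 2))) w)
      with (~ (cond F (fun v => b P v = true)
                 (cond F (fun v => b P v = true /\ b Q v = true)
                    (fun v => b R v = true)) w /\
               ~ cond F (fun v => b P v = true /\ b Q v = true)
                    (fun v => b R v = true) w) /\
            ~ (cond F (fun v => b P v = true /\ b Q v = true)
                    (fun v => b R v = true) w /\
               ~ cond F (fun v => b P v = true)
                 (cond F (fun v => b P v = true /\ b Q v = true)
                    (fun v => b R v = true)) w)) in H.
    assert (Hext : forall P P' Q Q' : F -> Prop,
               (forall v, P v <-> P' v) -> (forall v, Q v <-> Q' v) ->
               forall v, cond F P Q v <-> cond F P' Q' v).
    { intros P1 P2 Q1 Q2 HP HQ v. unfold cond.
      now setoid_rewrite HP; setoid_rewrite HQ. }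
    assert (HPQ : forall v, (b P v = true /\ b Q v = true) <-> (P v /\ Q v)).
    { intros v. now rewrite !Hb. }
    pose proof (Hext _ _ _ _ HPQ (Hb R)) as HC.
    pose proof (Hext _ _ _ _ (Hb P) HC) as HD.
    rewrite !HC, !HD in H. tauto.
  - intros H s (p & q & r & ->) V w.
    specialize (H (denot V p) (denot V q) (denot V r) w).
    unfold cond in H. simpl. tauto.
Qed.

Lemma flat_Flattening (F : order_frame) :
  flat F ->
  forall (P Q R : F -> Prop) (w : F),
    cond F P (cond F (fun v => P v /\ Q v) R) w <->
    cond F (fun v => P v /\ Q v) R w.
Proof.
  intros [Hsf Htr] P Q R w.
  destruct (classic (exists v, acc F w v /\ P v)) as [Hex | Hno].
  (* With no accessible [P]-world, both conditionals are vacuous. *)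
  2: { split; intros _; left; [| exact Hno].
       intros (v & Hv & HP & _). apply Hno. now exists v. }
  destruct (least_exists F P w Hex) as [y Hy].
  rewrite (cond_least F P _ w y Hy).
  pose proof Hy as (Hwy & _).
  destruct Hwy as [-> | Hwy]; [reflexivity |].
  (* A [P]-world of [R(w)] is [y] or comes after [y] in [<_w]; in the latter case semi-flatness puts
     it in [R(y)]. *)
  assert (Hacc : forall v, P v -> acc F w v -> acc F y v).
  { intros v HP Hv. destruct (least_le F P w y v Hy Hv HP) as [-> | Hyv].
    - now left.
    - apply (Hsf w y v Hyv). }
  destruct (classic (exists v, acc F w v /\ P v /\ Q v)) as [HexQ | HnoQ].
  - destruct (least_exists F (fun v => P v /\ Q v) w HexQ) as [m Hm].
    pose proof Hm as (Hwm & HPQm & _).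
    rewrite (cond_least F _ _ w m Hm).
    apply cond_least. split; [| split]; auto.
    + now apply Hacc.
    (* Suppose [x] precedes [m] in [<_y]. By transitivity [x] lies in [R(w)], so [m] precedes it in
       [<_w]. If [y = m], this contradicts that [m] comes first in [<_m]; otherwise semi-flatness
       places [m] before [x] in [<_y]. *)
    + intros x Hx HPQx.
      assert (Hwx : acc F w x).
      { apply (Htr w y x); [now right | exact (lt_acc_l F y x m Hx)]. }
      destruct (least_le F _ w m x Hm Hwx HPQx) as [-> | Hmx].
      * exact (lt_irrefl F y x Hx).
      * destruct (least_le F P w y m Hy Hwm (proj1 HPQm)) as [-> | Hym].
        -- destruct (lt_center F m x m Hx) as [-> | Hmx'].
           ++ exact (lt_irrefl F x x Hx).
           ++ exact (lt_irrefl F m x (lt_trans F m x m x Hx Hmx')).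
        -- pose proof (proj2 (Hsf w y m Hym) x (or_introl Hmx)) as Hmx'.
           exact (lt_irrefl F y x (lt_trans F y x m x Hx Hmx')).
  - split; intros _; left; [exact HnoQ |].
    intros (v & Hv & HPQ). apply HnoQ. exists v. split; auto.
    apply (Htr w y v); [now right | exact Hv].
Qed.

Lemma Flattening_flat (F : order_frame) :
  (forall (P Q R : F -> Prop) (w : F),
    cond F P (cond F (fun v => P v /\ Q v) R) w <->
    cond F (fun v => P v /\ Q v) R w) ->
  flat F.
Proof.
  intros Hfl.
  (* Here [x] is the least world of [{x, y}], and a conditional from [{y}] to the empty set says
     that [y] is inaccessible. Flattening thus equates the accessibility of [y] from [x] and from
     [w]. *)
  assert (Hnot : forall (w x y : F), acc F w x -> ~ lt w y x ->
            (acc F x y <-> acc F w y)).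
  { intros w x y Hwx Hyx.
    specialize (Hfl (fun v => v = x \/ v = y) (fun v => v = y)
                  (fun _ => False) w).
    rewrite (cond_least F _ _ w x) in Hfl.
    2: { split; [exact Hwx | split; [now left |]].
         intros v Hv [-> | ->]; [exact (lt_irrefl F w x Hv) | auto]. }
    assert (Hvac : forall u, cond F (fun v => (v = x \/ v = y) /\ v = y)
                               (fun _ => False) u <-> ~ acc F u y).
    { intros u. split.
      - intros [Hno | (v & (_ & _ & []) & _)] Hu.
        apply Hno. exists y. auto.
      - intros Hu. left. intros (v & Hv & _ & ->). auto. }
    rewrite !Hvac in Hfl. tauto. }
  assert (Htr : Transitive (acc F)).
  { intros w x y Hwx Hxy. destruct (classic (lt w y x)) as [H | H].
    - exact (lt_acc_l F w y x H).
    - now apply (Hnot w x y Hwx H). }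
  assert (Hsucc : forall w x y : F, lt w x y -> acc F x y).
  { intros w x y Hxy. apply (Hnot w x y (lt_acc_l F w x y Hxy)).
    - intros H. exact (lt_irrefl F w x (lt_trans F w x y x Hxy H)).
    - exact (lt_acc_r F w x y Hxy). }
  split; [| exact Htr].
  intros w x y Hxy. split; [exact (Hsucc w x y Hxy) |].
  intros z [Hyz | [Hxz Hwz]].
  (* Transitivity gives [R(x)] included in [R(w)]. *)
  2: { contradict Hwz. exact (Htr w x z (lt_acc_l F w x y Hxy) Hxz). }
  pose proof (lt_trans F w x y z Hxy Hyz) as Hxz.
  (* From [w], the least world of [{x, y, z}] is [x] and that of [{y, z}] is [y], so the right side
     holds. The left side then says that [y] is also the least world of [{y, z}] from [x]. *)
  specialize (Hfl (fun v => v = x \/ v = y \/ v = z)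
                (fun v => v = y \/ v = z) (fun v => v = y) w).
  rewrite (cond_least F _ _ w x) in Hfl.
  2: { split; [exact (lt_acc_l F w x y Hxy) | split; [now left |]].
       intros v Hv [-> | [-> | ->]].
       - exact (lt_irrefl F w x Hv).
       - exact (lt_irrefl F w x (lt_trans F w x y x Hxy Hv)).
       - exact (lt_irrefl F w x (lt_trans F w x z x Hxz Hv)). }
  rewrite (cond_least F _ _ w y) in Hfl.
  2: { split; [exact (lt_acc_r F w x y Hxy) | split; [auto |]].
       intros v Hv [_ [-> | ->]].
       - exact (lt_irrefl F w y Hv).
       - exact (lt_irrefl F w y (lt_trans F w y z y Hyz Hv)). }
  destruct (proj2 Hfl eq_refl) as [Hno | (v & (_ & _ & ->) & Hmin)].
  - contradict Hno. exists y. split; [exact (Hsucc w x y Hxy) | auto].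
  - destruct (lt_total F x y z (Hsucc w x y Hxy) (Hsucc w x z Hxz))
      as [H | [-> | H]]; auto.
    + now apply lt_irrefl in Hyz.
    + exfalso. apply (Hmin z H). auto.
Qed.

Theorem theorem4p3 (F : order_frame) : valid F Flattening <-> flat F.
Proof.
  rewrite valid_Flattening_sets. split.
  - apply Flattening_flat.
  - apply flat_Flattening.
Qed.
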